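(* Let $n\ge2$, $\tau\mid n$ and $M:=n/\tau$. (a) If $M=2$, then the necklaces $\mathcal N\in\mathcal D_2(n)$ with $K_2(\mathcal N)=\tau(\mathbb Z/n\mathbb Z)\setminus\{0\}$ are exactly the pure half-turn classes, i.e. those with $K_2(\mathcal N)=\{n/2\}$. (b) If $M=3$, or $M$ is even and $M\ge4$, or $M$ is odd and $M\ge5$, then the map $c\mapsto[w(c)]$ identifies the primitive words $c\in\{0,1\}^\tau$ bijectively with the slice $\mathcal D_2^{\mathrm{SP}}(n;3)$ (when $M=3$), $\mathcal D_2^{\mathrm{HT}}(n;\tau)$ (when $M\ge4$ is even), $\mathcal D_2^{\mathrm{SUB}}(n;\tau)$ (when $M\ge5$ is odd), and hence that slice has cardinality $$\mathsf P(\tau)=\sum_{d\mid\tau}\mu(d)2^{\tau/d}.$$ (c) In the cases covered by (b), for every necklace $\mathcal N$ in the slice, $\tau$ is the least positive element of $K_2(\mathcal N)$ and, when $M$ is odd and $M\ge5$, $\tau$ is the strict period of $\mathcal N$.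
   Context: Words $w\in\{0,1\}^n$ are indexed by $\mathbb Z/n\mathbb Z$; $(\mathrm{rot}^k w)_i=w_{i-k}$; a binary necklace of length $n$ is a rotation orbit $[w]$. A word is primitive if no nonzero rotation fixes it (for length $1$, both words are primitive). $d_w(k)=|\{i:w_i\ne w_{i-k}\}|$, $\delta(w)=\min_{1\le k\le n-1}d_w(k)$, $K_2(w)=\{k\in\{1,\dots,n-1\}:d_w(k)=2\}$, viewed in $\mathbb Z/n\mathbb Z\setminus\{0\}$; these depend only on the necklace. $\tau(\mathbb Z/n\mathbb Z)\setminus\{0\}$ is the set of nonzero residues represented by multiples of $\tau$. $\mu$ is the Möbius function. For $c=(c_0,\dots,c_{\tau-1})\in\{0,1\}^\tau$, $w(c)\in\{0,1\}^n$ is given by $w_0=1-c_0$, $w_{t\tau}=c_0$ for $1\le t\le M-1$, and $w_{r+t\tau}=c_r$ for $1\le r\le\tau-1$, $0\le t\le M-1$. $\mathcal D_2(n)$ is the set of necklaces of length $n$ with $\delta=2$. $\mathcal D_2^{\mathrm{SP}}(n;3)$ (for $3\mid n$): $\mathcal N\in\mathcal D_2(n)$ with $K_2(\mathcal N)=\{k,n-k\}$ for some $1\le k<n/2$, where $k$ has order $3$ in $\mathbb Z/n\mathbb Z$. $\mathcal D_2^{\mathrm{HT}}(n;\tau)$ ($n$ even, $\tau\mid n/2$): $\mathcal N\in\mathcal D_2(n)$ with $n/2\in K_2(\mathcal N)$ and $K_2(\mathcal N)=\tau(\mathbb Z/n\mathbb Z)\setminus\{0\}$. $\mathcal D_2^{\mathrm{SUB}}(n;\tau)$: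 $\mathcal N\in\mathcal D_2(n)$ with $K_2(\mathcal N)=\tau(\mathbb Z/n\mathbb Z)\setminus\{0\}$, $|K_2(\mathcal N)|>2$ and, if $n$ is even, $n/2\notin K_2(\mathcal N)$; in this case the divisor $\tau$ is called the strict period of $\mathcal N$. *)

(* Defs.v *)
From HB Require Import structures.
From mathcomp Require Import all_boot all_order all_algebra all_fingroup.

Set Implicit Arguments.
Unset Strict Implicit.
Unset Printing Implicit Defensive.

Import GRing.Theory.
Local Open Scope ring_scope.

(* Z/nZ for every n >= 1.  Unlike 'Z_n, this is the right group for n = 1 as
   well, and 'I_m.+1 carries the additive (zmodType and finGroupType) structure
   of the integers mod m.+1; [inZp m] is the residue class of the natural m. *)
Notation residue n := 'I_n.-1.+1.

Definition word (n : nat) := {ffun residue n -> bool}.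

Definition rotw n (k : residue n) (w : word n) : word n := [ffun i => w (i - k)].

Definition primitive n (w : word n) : bool :=
  [forall k : residue n, (k != 0) ==> (rotw k w != w)].

Definition dist n (w : word n) (k : residue n) : nat :=
  #|[set i : residue n | w i != w (i - k)]|.

(* dist w k <= n, so for n >= 2 the default value n is absorbed. *)
Definition delta n (w : word n) : nat :=
  \big[minn/n]_(k : residue n | k != 0) dist w k.

Definition K2 n (w : word n) : {set residue n} :=
  [set k : residue n | (k != 0) && (dist w k == 2%N)].

Definition necklace n (w : word n) : {set word n} :=
  [set rotw k w | k : residue n].

Definition necklaces n : {set {set word n}} :=
  [set necklace w | w : word n].

(* A representative of a necklace; [delta_neck_necklace] and
   [K2_neck_necklace] below show that the choice is immaterial. *)
Definition neck_repr n (N : {set word n}) : word n :=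
  odflt [ffun=> false] [pick w in N].

Definition delta_neck n (N : {set word n}) : nat := delta (neck_repr N).

Definition K2_neck n (N : {set word n}) : {set residue n} := K2 (neck_repr N).

Lemma dist_rotw n (j k : residue n) (w : word n) :
  dist (rotw j w) k = dist w k.
Proof.
rewrite /dist -(card_imset [set i | w i != w (i - k)] (addIr j)).
apply: eq_card => i; apply/idP/imsetP => [|[x]]; rewrite !inE.
  rewrite !ffunE => wi; exists (i - j); last by rewrite subrK.
  by rewrite inE addrAC.
by move=> wx ->; rewrite !ffunE addrK addrAC addrK.
Qed.

Lemma neck_repr_necklace n (w : word n) :
  exists k : residue n, neck_repr (necklace w) = rotw k w.
Proof.
rewrite /neck_repr; case: pickP => [v /imsetP[k _ ->]|no_v]; first by exists k.
by have /imsetP[] := negbT (no_v (rotw 0 w)); exists 0.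
Qed.

Lemma delta_neck_necklace n (w : word n) : delta_neck (necklace w) = delta w.
Proof.
rewrite /delta_neck; have [j ->] := neck_repr_necklace w.
by apply: eq_bigr => k _; rewrite dist_rotw.
Qed.

Lemma K2_neck_necklace n (w : word n) : K2_neck (necklace w) = K2 w.
Proof.
rewrite /K2_neck; have [j ->] := neck_repr_necklace w.
by apply/setP => k; rewrite !inE dist_rotw.
Qed.

Definition nz_multiples n (tau : nat) : {set residue n} :=
  [set k *+ tau | k : residue n] :\ 0.

(* The residue n/2, meaningful for even n. *)
Definition half_turn n : residue n := inZp (n %/ 2).

Definition D2 n : {set {set word n}} :=
  [set N in necklaces n | delta_neck N == 2%N].

Definition D2_pure_half n : {set {set word n}} :=
  [set N in D2 n | ~~ odd n && (K2_neck N == [set half_turn n])].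

(* #[k] is the additive order of k; [- k] is the residue n - k. *)
Definition D2_SP n (m : nat) : {set {set word n}} :=
  [set N in D2 n | [exists k : residue n,
     [&& (1 <= k)%N, (2 * k < n)%N, #[k]%g == m
       & K2_neck N == [set k; - k]]]].

Definition D2_HT n (tau : nat) : {set {set word n}} :=
  [set N in D2 n | [&& ~~ odd n, (tau %| n %/ 2)%N, half_turn n \in K2_neck N
     & K2_neck N == nz_multiples n tau]].

Definition D2_SUB n (tau : nat) : {set {set word n}} :=
  [set N in D2 n | [&& K2_neck N == nz_multiples n tau, (2 < #|K2_neck N|)%N
     & ~~ odd n ==> (half_turn n \notin K2_neck N)]].

Definition strict_period n (N : {set word n}) (tau : nat) : Prop :=
  (tau %| n)%N /\ N \in D2_SUB n tau.

(* Residues are compared through their representatives in {0, ..., n - 1};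
   K2 does not contain 0, so all its elements are positive. *)
Definition least_in_K2 n (N : {set word n}) (t : nat) : Prop :=
  (exists2 k : residue n, k \in K2_neck N & k = t :> nat) /\
  (forall k : residue n, k \in K2_neck N -> (t <= k)%N).

(* The index i = r + t * tau with 0 <= r < tau gets the letter c_r, r being
   the class of i mod tau, except that the letter at index 0 is flipped. *)
Definition wc n tau (c : word tau) : word n :=
  [ffun i : residue n => if i == 0 then ~~ c 0 else c (inZp i)].

Definition mobius (d : nat) : int :=
  if all (fun p => logn p d == 1%N) (primes d)
  then (-1) ^+ size (primes d) else 0.

Definition primitive_count (tau : nat) : int :=
  \sum_(d <- divisors tau) mobius d * 2 ^+ (tau %/ d)%N.

Definition primitive_words tau : {set word tau} :=
  [set c : word tau | primitive c].

Definition bijects_onto (S T : finType) (f : S -> T) (A : {set S}) (B : {set T}) : Prop :=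
  {in A &, injective f} /\ f @: A = B.

(* Main.v *)
(* Write M = n / tau.  The word w(c) is the pullback of c along the reduction
   Z/n -> Z/tau, flipped at the single index 0.  A shift by a nonzero multiple
   of tau only sees the two flips, so it has distance 2; any other shift moves
   a primitive c in at least 2 places, hence the pullback in at least 2M
   places, and the flips undo at most 2 of them: the distance is at least
   2M - 2 > 2.

   Conversely, if all M - 1 nonzero multiples of tau have distance 2, let A_r
   and B_r be the numbers of ones and zeros of w in the coset r.  Summing the
   distances over these multiples counts the unequal ordered pairs within
   cosets, so sum_r A_r B_r = M - 1 with A_r + B_r = M.  A coset that is not
   constant already contributes A_r B_r >= M - 1, with equality only if A_r or
   B_r is 1; so exactly one letter has to be flipped to make w periodic.

   The count is Moebius inversion: 2^(tau/d) words are fixed by the rotation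
   by tau/d, and such a rotation fixes c iff d divides the order of the
   stabilizer of c, which is trivial iff c is primitive. *)
Require Import Defs.
From mathcomp Require Import all_boot all_order all_algebra all_fingroup.
From mathcomp Require Import cyclic zify.

Set Implicit Arguments.
Unset Strict Implicit.
Unset Printing Implicit Defensive.

Import GRing.Theory.
Local Open Scope ring_scope.

(** * Reduction from Z/n to Z/tau and its fibres *)

Definition reduce n tau (i : residue n) : residue tau := inZp i.

Lemma reduceD n tau (i j : residue n) : (0 < n)%N -> (tau %| n)%N ->
  reduce tau (i + j) = reduce tau i + reduce tau j.
Proof.
move=> n0 tn; have t0 := dvdn_gt0 n0 tn.
have tn' : (tau.-1.+1 %| n.-1.+1)%N by rewrite !prednK.
by apply: val_inj; rewrite /= modn_dvdm // modnDm.
Qed.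

Lemma reduce0 n tau : reduce tau (0 : residue n) = 0.
Proof. by apply: val_inj; rewrite /= mod0n. Qed.

Lemma reduceB n tau (i j : residue n) : (0 < n)%N -> (tau %| n)%N ->
  reduce tau (i - j) = reduce tau i - reduce tau j.
Proof.
move=> n0 tn; apply: (addIr (reduce tau j)).
by rewrite -reduceD // !subrK.
Qed.

Lemma val_inZp n i : (0 < n)%N -> (inZp i : residue n) = (i %% n)%N :> nat.
Proof. by move=> n0; rewrite /= prednK. Qed.

Lemma reduce_lift n tau (r : residue tau) : (0 < n)%N -> (tau %| n)%N ->
  reduce tau (inZp r : residue n) = r.
Proof.
move=> n0 tn; have t0 := dvdn_gt0 n0 tn.
have tn' : (tau.-1.+1 %| n.-1.+1)%N by rewrite !prednK.
by apply: val_inj; rewrite /= modn_dvdm // modn_small.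
Qed.

Lemma reduce_eq0 n tau (k : residue n) : (0 < tau)%N ->
  (reduce tau k == 0) = (tau %| k)%N.
Proof. by case: tau => // t _; rewrite -val_eqE. Qed.

Lemma mem_nz_multiples n tau (k : residue n) : (0 < n)%N -> (tau %| n)%N ->
  (k \in nz_multiples n tau) = (k != 0) && (reduce tau k == 0).
Proof.
move=> n0 tn; have t0 := dvdn_gt0 n0 tn.
rewrite !inE reduce_eq0 //; congr (_ && _).
apply/imsetP/idP => [[j _ ->]|/dvdnP[q kE]].
  by rewrite Zp_mulrn val_inZp // /dvdn modn_dvdm // -/(dvdn _ _) dvdn_mull.
exists (inZp q) => //; rewrite Zp_mulrn; apply: val_inj => /=.
by rewrite modnMml -kE modn_small.
Qed.

(** All fibres are translates of the kernel, hence equally large, and the [tau] of them partition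
    the [n] residues. *)
Lemma card_reduce_fiber n tau (r : residue tau) : (0 < n)%N -> (tau %| n)%N ->
  #|[set i : residue n | reduce tau i == r]| = (n %/ tau)%N.
Proof.
move=> n0 tn; have t0 := dvdn_gt0 n0 tn.
have shift s : #|[set i : residue n | reduce tau i == s]| =
    #|[set i : residue n | reduce tau i == 0]|.
  rewrite -[RHS](card_imset _ (addIr (inZp s : residue n))).
  apply: eq_card => i; rewrite !inE; apply/idP/imsetP => [/eqP es|[j]].
    by exists (i - inZp s); rewrite ?subrK // inE reduceB // reduce_lift // es subrr.
  by rewrite inE => /eqP j0 ->; rewrite reduceD // reduce_lift // j0 add0r.
have: (\sum_(s : residue tau) #|[set i : residue n | reduce tau i == s]| = n)%N.
  have nE : #|{: residue n}| = n by rewrite card_ord prednK.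
  rewrite -[RHS]nE -sum1_card.
  rewrite [RHS](partition_big (reduce tau) xpredT) //=.
  by apply: eq_bigr => s _; rewrite sum1dep_card.
rewrite (eq_bigr (fun=> #|[set i : residue n | reduce tau i == r]|)).
  rewrite sum_nat_const card_ord; set f := #|_|; rewrite prednK // => fE.
  by rewrite -fE mulKn.
by move=> s _; rewrite !shift.
Qed.

(** * Distances and minimal distance of the words w(c) *)

Lemma wcE n tau (c : word tau) (i : residue n) :
  wc n c i = (i == 0) (+) c (reduce tau i).
Proof. by rewrite ffunE; case: eqP => // ->; rewrite reduce0. Qed.

(** A rotation preserves the number of ones, so as many positions change from one to zero as from
    zero to one. The distance is therefore even, and it vanishes only if the rotation fixes [w]. *)
Lemma dist_ge2 n (w : word n) (k : residue n) : rotw k w != w -> (2 <= dist w k)%N.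
Proof.
move=> wk; pose A := [set i | w i]; pose B := [set i | w (i - k)].
have AB : #|A| = #|B|.
  rewrite -(card_imset _ (addIr k)); apply: eq_card => i.
  rewrite inE; apply/imsetP/idP => [[j]|wi]; first by rewrite inE => wj ->; rewrite addrK.
  by exists (i - k); rewrite ?subrK // inE.
have -> : dist w k = (#|A :\: B| + #|B :\: A|)%N.
  have I0 : (A :\: B) :&: (B :\: A) = set0.
    by apply/setP=> i; rewrite !inE; case: (w i); rewrite ?andbF.
  rewrite /dist -cardsUI I0 cards0 addn0; apply: eq_card => i; rewrite !inE.
  by case: (w i); case: (w _).
have E : #|A :\: B| = #|B :\: A|.
  by apply/eqP; rewrite -(eqn_add2l #|A :&: B|) cardsID setIC cardsID AB.
rewrite E addnn -{1}[2%N]/(1.*2)%N leq_double card_gt0.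
apply: contraNneq wk => D0; apply/eqP/ffunP=> i; rewrite ffunE.
have D0' : A :\: B = set0 by apply/eqP; rewrite -cards_eq0 E D0 cards0.
have /setP/(_ i) := D0; have /setP/(_ i) := D0'.
by rewrite !inE; case: (w i); case: (w _).
Qed.

(** The pullback of [c] is invariant under [k], so only the flips, at 0 and at [k], are seen.
    Besides the multiples of [tau], this covers shifts whose reduction is a nonzero period of [c];
    that case later forces [c] to be primitive. *)
Lemma dist_wc_fixed n tau (c : word tau) (k : residue n) :
  (0 < n)%N -> (tau %| n)%N -> k != 0 -> rotw (reduce tau k) c = c -> dist (wc n c) k = 2%N.
Proof.
move=> n0 tn k0 ck.
rewrite /dist (_ : [set i | _] = [set 0; k]); first by rewrite cards2 eq_sym k0.
apply/setP => i; rewrite !inE !wcE reduceB // subr_eq0.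
have /ffunP/(_ (reduce tau i)) := ck; rewrite ffunE => ->.
case: (i =P 0) => [->|_]; first by rewrite (eq_sym 0) (negPf k0); case: (c _).
by case: (i =P k); case: (c _).
Qed.

Lemma rotw0 n (w : word n) : rotw 0 w = w.
Proof. by apply/ffunP => i; rewrite !ffunE subr0. Qed.

Lemma dist_wc_nonmultiple n tau (c : word tau) (k : residue n) :
  (0 < n)%N -> (tau %| n)%N -> (3 <= n %/ tau)%N -> primitive c ->
  reduce tau k != 0 -> (4 <= dist (wc n c) k)%N.
Proof.
move=> n0 tn M3 /forallP cp rk; pose D := [set r | c r != c (r - reduce tau k)].
have D_ge2 : (2 <= #|D|)%N by apply: dist_ge2; have := cp (reduce tau k); rewrite rk.
pose E := [set i : residue n | reduce tau i \in D].
have cE : #|E| = (#|D| * (n %/ tau))%N.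
  rewrite -sum1_card (partition_big (reduce tau) (mem D)) /=; last by move=> i; rewrite inE.
  rewrite -sum_nat_const; apply: eq_bigr => r rD.
  rewrite -(card_reduce_fiber r n0 tn) sum1dep_card; apply: eq_card => i.
  rewrite inE in rD; rewrite !inE.
  by case: (reduce tau i =P r) => [->|]; rewrite ?andbF // andbT rD.
(* [E] is where the unflipped pullback of [c] changes under [k]; away from 0 and [k] the flips do
   not interfere. This costs at most 2 of at least 2 * 3 positions, whence the bound 4. *)
have sE : E \subset [set i | wc n c i != wc n c (i - k)] :|: [set 0; k].
  apply/subsetP => i; rewrite !inE !wcE reduceB // subr_eq0.
  by case: (i == 0); case: (i == k); rewrite ?orbT //= orbF.
have := leq_trans (subset_leq_card sE) (leq_card_setU _ _).
rewrite cE cards2 -[X in (X + _)%N]/(dist (wc n c) k) => /(leq_trans (leq_mul D_ge2 M3)).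
by move: (dist _ _) => d; case: (0 != k) => /=; lia.
Qed.

Lemma K2_wc n tau (c : word tau) :
  (0 < n)%N -> (tau %| n)%N -> (3 <= n %/ tau)%N -> primitive c ->
  K2 (wc n c) = nz_multiples n tau.
Proof.
move=> n0 tn M3 cp; apply/setP=> k; rewrite mem_nz_multiples // inE.
case: eqP => //= /eqP k0; case: (altP (reduce tau k =P 0)) => [rk|rk].
  by rewrite dist_wc_fixed ?rk ?rotw0.
by apply/eqP => h; have := dist_wc_nonmultiple n0 tn M3 cp rk; rewrite h.
Qed.

Lemma dist_ge2_wc n tau (c : word tau) (k : residue n) :
  (0 < n)%N -> (tau %| n)%N -> (3 <= n %/ tau)%N -> primitive c ->
  k != 0 -> (2 <= dist (wc n c) k)%N.
Proof.
move=> n0 tn M3 cp k0; case: (altP (reduce tau k =P 0)) => [rk|rk].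
  by rewrite dist_wc_fixed ?rk ?rotw0.
by have := dist_wc_nonmultiple n0 tn M3 cp rk; lia.
Qed.

Lemma inZp_tau_neq0 n tau : (0 < tau)%N -> (tau < n)%N -> (inZp tau : residue n) != 0.
Proof. by move=> t0 tn; rewrite -val_eqE /= prednK ?modn_small //; lia. Qed.

Lemma mem_nz_multiples_tau n tau : (tau %| n)%N -> (0 < tau)%N -> (tau < n)%N ->
  (inZp tau : residue n) \in nz_multiples n tau.
Proof.
move=> tn t0 ltn; have n0 := ltn_trans t0 ltn.
by rewrite mem_nz_multiples // inZp_tau_neq0 // reduce_eq0 // val_inZp ?modn_small ?dvdnn.
Qed.

Lemma bigminn_le (T : eqType) (s : seq T) (P : pred T) (F : T -> nat) (m : nat) (k : T) :
  k \in s -> P k -> (\big[minn/m]_(i <- s | P i) F i <= F k)%N.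
Proof.
move=> + Pk; elim: s => // j s IHs; rewrite in_cons big_cons => /predU1P[<-|/IHs le_k].
  by rewrite Pk geq_minl.
by case: (P j); rewrite // geq_min le_k orbT.
Qed.

Lemma delta_eq2 n (w : word n) (k : residue n) : (2 <= n)%N ->
  (forall j, j != 0 -> (2 <= dist w j)%N) -> k != 0 -> dist w k = 2%N -> delta w = 2%N.
Proof.
move=> n2 ge2 k0 wk; apply/eqP; rewrite eqn_leq /delta; apply/andP; split.
  by rewrite -wk; apply: bigminn_le; rewrite ?mem_index_enum.
(* The induction starts from the default value [n] of the minimum, which is where [2 <= n]
   enters. *)
by elim/big_ind: _ => // x y hx hy; rewrite leq_min hx.
Qed.

(** * Necklaces and injectivity of c -> [w(c)] *)

Lemma rotwD n (j k : residue n) (w : word n) : rotw j (rotw k w) = rotw (j + k) w.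
Proof. by apply/ffunP => i; rewrite !ffunE opprD addrA. Qed.

Lemma necklace_rotw n (k : residue n) (w : word n) : necklace (rotw k w) = necklace w.
Proof.
apply/setP => v; apply/imsetP/imsetP => -[j _ ->].
  by exists (j + k); rewrite ?rotwD.
by exists (j - k); rewrite ?rotwD ?subrK.
Qed.

Lemma necklace_eq n (w v : word n) : necklace w = necklace v -> exists k, v = rotw k w.
Proof.
move=> e; have : v \in necklace w by rewrite e; apply/imsetP; exists 0; rewrite ?rotw0.
by case/imsetP => k _ ->; exists k.
Qed.

(** Away from the flips, a rotation by [k] taking w(c) to w(c') shows that c' is [c] rotated by the
    class of [k]. The flips must then match too, which gives [k = 0]. *)
Lemma necklace_wc_inj n tau (c c' : word tau) :
  (0 < n)%N -> (tau %| n)%N -> (3 <= n %/ tau)%N ->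
  necklace (wc n c) = necklace (wc n c') -> c = c'.
Proof.
move=> n0 tn M3 /necklace_eq[k ck].
have ckE (i : residue n) : (i == 0) (+) c' (reduce tau i) =
    (i == k) (+) c (reduce tau i - reduce tau k).
  by have /ffunP/(_ i) := ck; rewrite [RHS]ffunE !wcE subr_eq0 reduceB.
(* A fibre of the reduction has at least 3 elements, so one avoids both flips. *)
have cr r : c' r = c (r - reduce tau k).
  have /subsetPn[i] : ~~ ([set i : residue n | reduce tau i == r] \subset [set 0; k]).
    apply: contraTN M3 => /subset_leq_card; rewrite card_reduce_fiber // cards2.
    by case: (0 != k) => /=; lia.
  rewrite !inE negb_or => /eqP ir /andP[/negPf i0 /negPf ik].
  by have := ckE i; rewrite i0 ik ir.
(* At index [k] the two pullbacks agree and one side is flipped, so the other side must be flipped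
   there as well. *)
have k0 : k = 0.
  have := ckE k; rewrite cr eqxx.
  by case: eqP => //; case: (c _).
by apply/ffunP => r; rewrite cr k0 reduce0 subr0.
Qed.

(** * Recovering c from K2 by double counting *)

Lemma card_nz_multiples n tau : (0 < n)%N -> (tau %| n)%N ->
  #|nz_multiples n tau| = (n %/ tau).-1.
Proof.
move=> n0 tn; rewrite -(card_reduce_fiber 0 n0 tn) [in RHS](cardsD1 0) inE reduce0 eqxx.
by apply: eq_card => k; rewrite mem_nz_multiples // !inE.
Qed.

(** For [b] equal to [true] and [false] these are the numbers A_r and B_r of the overview. *)
Definition fiber_card n tau (w : word n) (r : residue tau) (b : bool) : nat :=
  #|[set i : residue n | (reduce tau i == r) && (w i == b)]|.

Lemma fiber_cardD n tau (w : word n) (r : residue tau) : (0 < n)%N -> (tau %| n)%N ->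
  (fiber_card w r true + fiber_card w r false)%N = (n %/ tau)%N.
Proof.
move=> n0 tn; rewrite -(card_reduce_fiber r n0 tn) -(cardsID [set i | w i]).
by congr (_ + _)%N; apply: eq_card => i; rewrite !inE; case: (w i); rewrite ?andbT ?andbF.
Qed.

(** Both sides count ordered pairs of indices in a common coset that carry different letters; the
    order accounts for the factor 2. The shift 0 has distance 0 and may be added, so that the sum
    runs over the whole kernel of the reduction. *)
Lemma sum_dist_multiples n tau (w : word n) : (0 < n)%N -> (tau %| n)%N ->
  (\sum_(k in nz_multiples n tau) dist w k =
   \sum_(r : residue tau) 2 * (fiber_card w r true * fiber_card w r false))%N.
Proof.
move=> n0 tn.
transitivity (\sum_(k : residue n | reduce tau k == 0%R) dist w k)%N.
  rewrite [RHS](bigD1 0%R) ?reduce0 //= [X in (_ = X + _)%N](_ : _ = 0%N) ?add0n.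
    by apply: eq_bigl => k; rewrite mem_nz_multiples // andbC.
  by apply/eqP; rewrite cards_eq0; apply/eqP/setP => i; rewrite !inE subr0 eqxx.
transitivity (\sum_(k : residue n | reduce tau k == 0%R) \sum_(i : residue n)
    (w i != w (i - k)%R))%N.
  by apply: eq_bigr => k _; rewrite /dist -sum1_card big_mkcond; apply: eq_bigr => i _;
    rewrite inE; case: (_ != _).
rewrite exchange_big /= (partition_big (reduce tau) xpredT) //=.
apply: eq_bigr => r _.
transitivity (\sum_(i : residue n | reduce tau i == r)
   fiber_card w r (~~ w i))%N.
  apply: eq_bigr => i /eqP ir.
  (* Substituting [i - j] for the shift makes [j] the second index of the pair. *)
  rewrite (reindex_inj (subrI i)) /= /fiber_card -sum1_card big_mkcond [RHS]big_mkcond /=.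
  apply: eq_bigr => j _; rewrite subKr reduceB // subr_eq0 ir inE eq_sym.
  by case: (_ == r) => //=; case: (w i); case: (w j).
rewrite (bigID w) /= (eq_bigr (fun=> fiber_card w r false)) => [|i /andP[_ ->]] //.
rewrite [X in (_ + X)%N](eq_bigr (fun=> fiber_card w r true)) => [|i /andP[_ /negPf->]] //.
have fiberE (b : bool) (P : pred (residue n)) : P =1 (fun i => w i == b) ->
    #|[pred i | (reduce tau i == r) && P i]| = fiber_card w r b.
  by move=> PE; rewrite /fiber_card cardsE; apply: eq_card => i; rewrite !inE PE.
rewrite !sum_nat_const (fiberE true w) => [|i]; last by rewrite eqb_id.
rewrite (fiberE false (fun i => ~~ w i)) => [|i]; last by rewrite eqbF_neg.
by rewrite [X in (_ + X)%N]mulnC addnn mul2n.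
Qed.

Lemma flip_word_of_K2 n tau (w : word n) :
  (0 < n)%N -> (tau %| n)%N -> (2 <= n %/ tau)%N -> K2 w = nz_multiples n tau ->
  exists (x : residue n) (c : word tau), forall i, w i = (i == x) (+) c (reduce tau i).
Proof.
move=> n0 tn M2 wK.
pose A (r : residue tau) := fiber_card w r true.
pose B (r : residue tau) := fiber_card w r false.
have AB r : (A r + B r = n %/ tau)%N by apply: fiber_cardD.
have sumAB : (\sum_(r : residue tau) A r * B r = (n %/ tau).-1)%N.
  apply/eqP; rewrite -(eqn_pmul2l (isT : (0 < 2)%N)) big_distrr /=.
  rewrite -(sum_dist_multiples w n0 tn) (eq_bigr (fun=> 2%N)).
    by rewrite sum_nat_const card_nz_multiples // mulnC.
  by move=> k; rewrite -wK inE => /andP[_ /eqP].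
(* The total M - 1 is positive, so some coset is not constant. *)
have /existsP[r ABr] : [exists r, 0 < A r * B r]%N.
  apply: contraLR M2 => /existsPn AB0; rewrite big1 in sumAB; first by lia.
  by move=> r _; apply/eqP; rewrite -leqn0 leqNgt AB0.
move: sumAB; rewrite (bigD1 r) //= => sumAB.
(* With A_r = a + 1, B_r = b + 1 and S the sum over the other cosets, the two equations leave ab + S
   = 0. *)
have [rest0 AB1] : (\sum_(s | s != r) A s * B s = 0)%N /\ (A r = 1 \/ B r = 1)%N.
  move: (AB r) ABr sumAB; move: (\sum_(s | _) _)%N (A r) (B r) => S [|a] [|b] //=.
    by rewrite muln0.
  by nia.
have others s : s != r -> (A s * B s = 0)%N.
  by move=> sr; move/eqP: rest0; rewrite sum_nat_eq0 => /forallP/(_ s); rewrite sr => /eqP.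
have [x [xr xP]] : exists x, reduce tau x = r /\
    forall i, reduce tau i = r -> w i = (i == x) (+) ~~ w x.
  have [b Sb] : exists b, fiber_card w r b = 1%N.
    by case: AB1; [exists true | exists false].
  move/eqP/cards1P: Sb => [x xb]; exists x.
  have : x \in [set x] by rewrite inE.
  rewrite -xb inE => /andP[/eqP xr /eqP wx]; split=> // i ir.
  have /setP/(_ i) := xb; rewrite !inE ir eqxx wx /= => <-.
  by case: (w i); case: (b).
(* On the coset [r], [c] takes the letter found away from [x]; every other coset is constant, so its
   letter can be read at any lift. *)
pose c := [ffun s => if s == r then ~~ w x else w (inZp s)].
exists x, c => i; rewrite ffunE.
case: (reduce tau i =P r) => [ir|/eqP ir]; first exact: xP.
have -> : (i == x) = false by apply: contraNF ir => /eqP->; apply/eqP.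
have /eqP := others _ ir; rewrite muln_eq0 !cards_eq0 => s0.
set j : residue n := inZp _; have ji : reduce tau j = reduce tau i by rewrite reduce_lift.
case/orP: s0 => /eqP/setP s0; have := s0 i; have := s0 j; rewrite !inE ji eqxx.
  by case: (w i); case: (w j).
by case: (w i); case: (w j).
Qed.

(** Rotating the exceptional index to 0 turns [w] into some w(c). If a nonzero [s] fixed [c], a lift
    of [s] would lie in [K2] without being a multiple of [tau]; hence [c] is primitive. *)
Lemma wc_of_K2 n tau (w : word n) :
  (0 < n)%N -> (tau %| n)%N -> (2 <= n %/ tau)%N -> K2 w = nz_multiples n tau ->
  exists2 c : word tau, primitive c & necklace w = necklace (wc n c).
Proof.
move=> n0 tn M2 wK; have [x [u wE]] := flip_word_of_K2 n0 tn M2 wK.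
pose c : word tau := [ffun s => u (s + reduce tau x)].
have wc_rot : rotw (- x) w = wc n c.
  apply/ffunP => i; rewrite wcE !ffunE opprK wE reduceD //; congr (_ (+) _).
  by rewrite -subr_eq0 addrK.
exists c; last by rewrite -wc_rot necklace_rotw.
have cK : K2 (wc n c) = nz_multiples n tau.
  by rewrite -wc_rot -wK; apply/setP => k; rewrite !inE dist_rotw.
apply/forallP => s; apply/implyP => s0; apply/eqP => sc.
pose k : residue n := inZp s; have ks : reduce tau k = s by rewrite reduce_lift.
have k0 : k != 0 by apply: contraNneq s0 => k0; rewrite -ks k0 reduce0.
have : k \in K2 (wc n c) by rewrite inE k0 dist_wc_fixed ?ks.
by rewrite cK mem_nz_multiples // ks (negPf s0) andbF.
Qed.

(** * The Moebius function and its divisor sums *)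

Lemma mobius_prime_mul (p d : nat) : prime p -> (0 < d)%N -> ~~ (p %| d)%N ->
  mobius (p * d) = - mobius d.
Proof.
move=> pp d0 pd; have p0 := prime_gt0 pp.
have pnp : p \notin primes d by rewrite mem_primes pp d0.
have pe : perm_eq (primes (p * d)) (p :: primes d).
  apply: uniq_perm; rewrite ?primes_uniq //= ?pnp ?primes_uniq // => q.
  by rewrite primesM // primes_prime // !inE.
rewrite /mobius (perm_all _ pe) (perm_size pe) /= lognM // logn_prime // eqxx.
rewrite lognE (negPf pd) !andbF /=.
rewrite (@eq_in_all _ _ (fun q => logn q d == 1%N)) => [|q qd].
  by case: ifP; rewrite ?oppr0 // exprS mulN1r.
rewrite lognM // logn_prime //; case: (q =P p) => // qp.
by move: pnp; rewrite -qp qd.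
Qed.

Lemma mobius_square_dvd (p d : nat) : prime p -> (0 < d)%N -> (p ^ 2 %| d)%N ->
  mobius d = 0.
Proof.
move=> pp d0 pd; rewrite /mobius ifN //; apply/allPn; exists p.
  by rewrite mem_primes pp d0 (dvdn_trans _ pd) // dvdn_exp.
by move: pd; rewrite pfactor_dvdn //; case: eqP => // ->.
Qed.

(** For [e > 1] and a prime [p] dividing [e], divisors divisible by the square of [p] contribute 0,
    and those divisible by [p] exactly once cancel, through d -> pd, against those prime to [p]. *)
Lemma sum_mobius (e : nat) : (0 < e)%N ->
  \sum_(d <- divisors e) mobius d = (e == 1%N)%:R.
Proof.
move=> e0; case: eqP => [->|/eqP e1].
  by rewrite (_ : divisors 1 = [:: 1%N]) // big_seq1.
have pp : prime (pdiv e) by rewrite pdiv_prime //; lia.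
set p := pdiv e in pp; have p0 := prime_gt0 pp.
rewrite (bigID (fun d => (p %| d)%N)) /= (bigID (fun d => (p ^ 2 %| d)%N)) /=.
rewrite big_seq_cond big1 => [|d /andP[]]; last first.
  rewrite -dvdn_divisors // => de /andP[_]; apply: mobius_square_dvd => //.
  exact: dvdn_gt0 de.
rewrite add0r -big_filter.
have pe : perm_eq [seq d <- divisors e | (p %| d)%N && ~~ (p ^ 2 %| d)%N]
    [seq (p * d)%N | d <- [seq d <- divisors e | ~~ (p %| d)%N]].
  apply: uniq_perm.
  - by rewrite filter_uniq ?divisors_uniq.
  - rewrite map_inj_uniq ?filter_uniq ?divisors_uniq //.
    by move=> x y /eqP; rewrite eqn_pmul2l // => /eqP.
  move=> d; rewrite mem_filter -dvdn_divisors //; apply/idP/mapP.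
    case/andP => /andP[/dvdnP[q ->] pq] de; exists q; last by rewrite mulnC.
    rewrite mem_filter -dvdn_divisors // (dvdn_trans _ de) ?dvdn_mulr // andbT.
    by apply: contra pq; rewrite expnS expn1 dvdn_pmul2r.
  case=> q; rewrite mem_filter -dvdn_divisors // => /andP[pq qe] ->.
  rewrite dvdn_mulr //= expnS expn1 dvdn_pmul2l // pq /=.
  by rewrite Gauss_dvd ?pdiv_dvd // prime_coprime.
rewrite (perm_big _ pe) /= big_map big_filter -big_split /=.
rewrite big_seq_cond big1 // => d /andP[].
rewrite -dvdn_divisors // => de pd.
by rewrite mobius_prime_mul ?addNr //; apply: dvdn_gt0 de.
Qed.

(** * Words fixed by a rotation, stabilizers and the number of primitive words *)

Lemma rotw_mulrn n (k : residue n) (w : word n) m : rotw k w = w -> rotw (k *+ m) w = w.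
Proof.
move=> kw; elim: m => [|m IHm]; first by rewrite mulr0n rotw0.
by rewrite mulrS -rotwD IHm.
Qed.

Lemma reduce_eq0_mulrn n tau (k : residue n) : (0 < n)%N -> (tau %| n)%N ->
  reduce tau k = 0 -> exists m, k = (inZp tau : residue n) *+ m.
Proof.
move=> n0 tn /eqP; rewrite reduce_eq0 ?(dvdn_gt0 n0) // => /dvdnP[m km].
by exists m; rewrite Zp_mulrn; apply: val_inj; rewrite /= modnMml mulnC -km modn_small.
Qed.

(** The fixed words are the pullbacks along the reduction of arbitrary words of length [tau]. *)
Lemma card_fixed_words n tau : (0 < n)%N -> (tau %| n)%N ->
  #|[set w : word n | rotw (inZp tau) w == w]| = (2 ^ tau)%N.
Proof.
move=> n0 tn; have t0 := dvdn_gt0 n0 tn.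
pose f (g : word tau) : word n := [ffun i => g (reduce tau i)].
have rtau : reduce tau (inZp tau : residue n) = 0.
  by apply/eqP; rewrite reduce_eq0 // val_inZp // /dvdn modn_dvdm // modnn.
have -> : [set w : word n | rotw (inZp tau) w == w] = [set f g | g : word tau].
  apply/setP => w; rewrite inE; apply/eqP/imsetP => [wfix|[g _ ->]].
    exists [ffun r : residue tau => w (inZp r)] => //; apply/ffunP => i; rewrite !ffunE.
    (* An index and the chosen lift of its class differ by a multiple of [tau], under which [w] is
       invariant. *)
    have [|m iE] := @reduce_eq0_mulrn _ _ (i - inZp (reduce tau i)) n0 tn.
      by rewrite reduceB // reduce_lift // subrr.
    have /ffunP/(_ i) := rotw_mulrn m wfix.
    by rewrite ffunE -iE subKr.
  by apply/ffunP => i; rewrite !ffunE reduceB // rtau subr0.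
rewrite card_imset => [|g h /ffunP gh].
  by rewrite card_ffun card_bool card_ord prednK.
apply/ffunP => r; have := gh (inZp r).
by rewrite !ffunE reduce_lift.
Qed.

(** Made into a subgroup of Z/n below, so that Lagrange's theorem and the structure of cyclic groups
    apply. *)
Definition stabilizer n (w : word n) : {set residue n} := [set k | rotw k w == w].

Lemma stabilizer_group_set n (w : word n) : group_set (stabilizer w).
Proof.
apply/group_setP; split=> [|j k]; first by rewrite inE rotw0.
by rewrite !inE => /eqP jw /eqP kw; rewrite -rotwD kw jw.
Qed.

Canonical stabilizer_group n (w : word n) := Group (stabilizer_group_set w).

Lemma primitive_stabilizer n (w : word n) : primitive w = (#|stabilizer w| == 1%N).
Proof.
apply/forallP/eqP => [wp|/eqP/cards1P[x wx] k].
  apply/eqP/cards1P; exists 0; apply/setP => k; rewrite !inE.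
  by have := wp k; case: (k =P 0) => [->|_ /negPf->//]; rewrite rotw0 eqxx.
apply/implyP; apply: contraNN => kw.
have : 0 \in stabilizer w by rewrite inE rotw0.
have : k \in stabilizer w by rewrite inE.
by rewrite wx !inE => /eqP-> /eqP->.
Qed.

Lemma card_stabilizer_dvd n (w : word n) : (0 < n)%N -> (#|stabilizer w| %| n)%N.
Proof.
move=> n0; have := cardSg (subsetT (stabilizer_group w)).
by rewrite cardsT card_ord; set m := #|_|; rewrite prednK.
Qed.

Lemma order_inZp_div n d : (0 < n)%N -> (d %| n)%N ->
  #[inZp (n %/ d) : residue n]%g = d.
Proof.
move=> n0 dn; have -> : inZp (n %/ d) = (Zp1 ^+ (n %/ d))%g :> residue n.
  by rewrite Zp_expg; apply: val_inj; rewrite /= modnMml mul1n.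
rewrite orderXdiv order_Zp1 prednK ?dvdn_div //.
by rewrite divnA // mulKn.
Qed.

(* Subgroups of the cyclic group Z/n are ordered by divisibility of their orders. *)
Lemma rotw_fixed_dvd n (w : word n) d : (0 < n)%N -> (d %| n)%N ->
  (rotw (inZp (n %/ d)) w == w) = (d %| #|stabilizer w|)%N.
Proof.
move=> n0 dn; have cyc : cyclic [set: residue n] by rewrite Zp_cycle cycle_cyclic.
rewrite -{2}(order_inZp_div n0 dn) orderE (cardSg_cyclic cyc) ?subsetT //.
by rewrite cycle_subG inE.
Qed.

(** The indicator of a stabilizer of order 1 is the sum of the Moebius function over the divisors of
    that order. Exchanging sums, each [d] is weighted by the number of words fixed by the rotation
    by [n %/ d]. *)
Lemma card_primitive_words n : (0 < n)%N ->
  #|primitive_words n|%:Z = primitive_count n.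
Proof.
move=> n0; rewrite /primitive_count.
transitivity (\sum_(w : word n) \sum_(d <- divisors n)
    (if (d %| #|stabilizer w|)%N then mobius d else 0)); last first.
  rewrite exchange_big; apply: eq_big_seq => d; rewrite -dvdn_divisors // => dn /=.
  have dn' : (n %/ d %| n)%N by rewrite dvdn_div.
  rewrite -natrX -(card_fixed_words n0 dn') -big_mkcond.
  rewrite (eq_bigl [in [set w : word n | rotw (inZp (n %/ d)) w == w]]) => [|w].
    by rewrite sumr_const mulr_natr.
  by rewrite inE rotw_fixed_dvd.
rewrite -natz -sum1_card natr_sum big_mkcond; apply: eq_bigr => w _.
rewrite inE primitive_stabilizer -big_mkcond -big_filter.
have s0 : (0 < #|stabilizer w|)%N by apply: cardG_gt0.
(* The stabilizer has order dividing [n], so the divisors of [n] that divide this order are all of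
   its divisors. *)
rewrite (perm_big (divisors #|stabilizer w|)) ?sum_mobius //=; first by case: eqP.
apply: uniq_perm; rewrite ?filter_uniq ?divisors_uniq // => d.
rewrite mem_filter -!dvdn_divisors //; case: (boolP (d %| _)%N) => //= ds.
exact: dvdn_trans ds (card_stabilizer_dvd w n0).
Qed.

(** * The common slice: bijection, cardinality and least element *)

(** The three families of part (b) are each shown to equal this set in their range of M, so the
    bijection, the count and the least element are established once. *)
Definition slice n tau : {set {set word n}} :=
  [set N in D2 n | K2_neck N == nz_multiples n tau].

Lemma wc_bijects_onto_slice n tau :
  (0 < n)%N -> (tau %| n)%N -> (3 <= n %/ tau)%N ->
  bijects_onto (fun c => necklace (wc n c)) (primitive_words tau) (slice n tau).
Proof.
move=> n0 tn M3; have t0 := dvdn_gt0 n0 tn.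
split=> [c c' _ _|]; first exact: necklace_wc_inj.
have ltn : (tau < n)%N by move: M3; rewrite leq_divRL //; lia.
apply/setP => N; rewrite !inE; apply/imsetP/idP => [[c]|].
  rewrite inE => cp ->; rewrite delta_neck_necklace K2_neck_necklace K2_wc // eqxx andbT.
  rewrite imset_f // (@delta_eq2 _ _ (inZp tau)) ?inZp_tau_neq0 //; first by lia.
    by move=> j; apply: dist_ge2_wc.
  by have := mem_nz_multiples_tau tn t0 ltn; rewrite -(K2_wc n0 tn M3 cp) inE => /andP[_ /eqP].
case/andP => /andP[/imsetP[w _ ->] _]; rewrite K2_neck_necklace => /eqP wK.
have [c cp cE] := wc_of_K2 n0 tn (ltnW M3) wK.
by exists c; rewrite // inE.
Qed.

Lemma card_slice n tau :
  (0 < n)%N -> (tau %| n)%N -> (3 <= n %/ tau)%N ->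
  #|slice n tau|%:Z = primitive_count tau.
Proof.
move=> n0 tn M3; have [inj <-] := wc_bijects_onto_slice n0 tn M3.
by rewrite card_in_imset // card_primitive_words // (dvdn_gt0 n0).
Qed.

Lemma least_in_slice n tau (N : {set word n}) :
  (0 < n)%N -> (tau %| n)%N -> (2 <= n %/ tau)%N -> N \in slice n tau -> least_in_K2 N tau.
Proof.
move=> n0 tn M2; have t0 := dvdn_gt0 n0 tn.
have ltn : (tau < n)%N by move: M2; rewrite leq_divRL //; lia.
rewrite inE => /andP[_ /eqP NK]; rewrite /least_in_K2 NK; split.
  by exists (inZp tau); rewrite ?mem_nz_multiples_tau // val_inZp // modn_small.
move=> k; rewrite mem_nz_multiples // reduce_eq0 // => /andP[k0].
by apply: dvdn_leq; rewrite lt0n.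
Qed.

(** Serves for the uniqueness of the strict period. *)
Lemma least_in_K2_inj n (N : {set word n}) s t :
  least_in_K2 N s -> least_in_K2 N t -> s = t.
Proof.
move=> [[j jN <-] minj] [[k kN <-] mink].
by apply/eqP; rewrite eqn_leq minj ?mink.
Qed.

(** * Identifying the slice with the half-turn, subgroup and order-3 families *)

(** [tau] divides n/2 iff 2 * [tau] divides [n], that is, iff 2 divides n / tau. *)
Lemma half_turn_nz_multiples n tau : (0 < n)%N -> (tau %| n)%N -> ~~ odd n ->
  (half_turn n \in nz_multiples n tau) = ~~ odd (n %/ tau).
Proof.
move=> n0 tn en; have t0 := dvdn_gt0 n0 tn.
have hE : half_turn n = (n %/ 2)%N :> nat by rewrite val_inZp // modn_small // ltn_Pdiv.
have h0 : half_turn n != 0.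
  by apply/eqP => h0; move: hE en; rewrite h0 /=; case: (n) n0 => [|[|m]] //; lia.
have n2 : (2 %| n)%N by rewrite dvdn2.
rewrite mem_nz_multiples // reduce_eq0 // h0 hE /=.
rewrite -(dvdn_pmul2r (isT : (0 < 2)%N)) divnK // -dvdn2.
by rewrite -[RHS](dvdn_pmul2r t0) divnK // mulnC.
Qed.

Lemma D2_HT_slice n tau : (0 < n)%N -> (tau %| n)%N -> ~~ odd (n %/ tau) ->
  D2_HT n tau = slice n tau.
Proof.
move=> n0 tn eM; have en : ~~ odd n by rewrite -(divnK tn) oddM negb_and eM.
apply/setP => N; rewrite [LHS]inE [RHS]inE en; congr (_ && _).
have -> : (tau %| n %/ 2)%N.
  have := half_turn_nz_multiples n0 tn en.
  rewrite eM mem_nz_multiples // => /andP[_]; rewrite reduce_eq0 ?(dvdn_gt0 n0) //.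
  by rewrite val_inZp // modn_small // ltn_Pdiv.
by case: eqP => [->|_]; rewrite ?andbF // half_turn_nz_multiples // eM.
Qed.

Lemma D2_SUB_slice n tau : (0 < n)%N -> (tau %| n)%N -> odd (n %/ tau) ->
  (3 < n %/ tau)%N -> D2_SUB n tau = slice n tau.
Proof.
move=> n0 tn oM M3; apply/setP => N; rewrite [LHS]inE [RHS]inE; congr (_ && _).
case: eqP => //= ->; rewrite card_nz_multiples //.
have -> : (2 < (n %/ tau).-1)%N by lia.
by apply/implyP => en; rewrite half_turn_nz_multiples // oM.
Qed.

Lemma nz_multiples_half n tau : (0 < n)%N -> (tau %| n)%N -> (n %/ tau)%N = 2%N ->
  nz_multiples n tau = [set half_turn n].
Proof.
move=> n0 tn M2; have nE := divnK tn; rewrite M2 in nE.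
apply/esym/eqP; rewrite eqEcard sub1set card_nz_multiples // M2 cards1 andbT.
by rewrite half_turn_nz_multiples // ?M2 // -nE oddM.
Qed.

Lemma nz_multiples_third n tau : (0 < n)%N -> (tau %| n)%N -> (n %/ tau)%N = 3%N ->
  nz_multiples n tau = [set inZp tau; - inZp tau].
Proof.
move=> n0 tn M3; have nE := divnK tn; rewrite M3 in nE.
have t0 := dvdn_gt0 n0 tn; have ltn : (tau < n)%N by lia.
have x_in := mem_nz_multiples_tau tn t0 ltn.
move: (x_in); rewrite mem_nz_multiples // => /andP[x0 /eqP rx].
apply/esym/eqP; rewrite eqEcard subUset !sub1set x_in /= card_nz_multiples // M3.
rewrite mem_nz_multiples // oppr_eq0 x0 -sub0r reduceB // rx subr0 reduce0 eqxx /=.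
(* If the class of [tau] were its own opposite, [n] would divide 2 * [tau], which lies strictly
   between 0 and n = 3 * [tau]. *)
rewrite cards2 sub0r; case: eqP => // /eqP; rewrite -addr_eq0 -val_eqE /=.
by rewrite modnDm prednK // modn_small; lia.
Qed.

Lemma D2_SP_slice n tau : (0 < n)%N -> (tau %| n)%N -> (n %/ tau)%N = 3%N ->
  D2_SP n 3 = slice n tau.
Proof.
move=> n0 tn M3; have nE := divnK tn; rewrite M3 in nE.
have t0 := dvdn_gt0 n0 tn; have ltn : (tau < n)%N by lia.
have xE : (inZp tau : residue n) = tau :> nat by rewrite val_inZp // modn_small.
apply/setP => N; rewrite [LHS]inE [RHS]inE; congr (_ && _); rewrite nz_multiples_third //.
apply/existsP/idP => [[k /and4P[k1 k2 /eqP k3 /eqP->]]|NK].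
  (* Order 3 gives that [n] divides 3k, while 0 < 2k < n gives 0 < 3k < 2n; so 3k = n and k is
     [tau]. *)
  have : (n %| k * 3)%N by rewrite /dvdn -val_inZp // -Zp_expg -k3 expg_order.
  case/dvdnP => [[|[|q]] kq]; try nia.
  by suff -> : k = inZp tau by []; apply: ord_inj; rewrite xE; lia.
exists (inZp tau); rewrite NK xE t0 andbT /=.
have d3 : (3 %| n)%N by rewrite -nE dvdn_mulr.
have <- : (n %/ 3)%N = tau by rewrite -nE mulKn.
by rewrite order_inZp_div // eqxx andbT; lia.
Qed.

Theorem corollary5p7 (n tau M : nat) (hn : (2 <= n)%N) (htau : (tau %| n)%N)
    (hM : M = (n %/ tau)%N) :
  (M = 2%N ->
     [set N in D2 n | K2_neck N == nz_multiples n tau] = D2_pure_half n) /\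
  ((M = 3%N ->
      bijects_onto (fun c => necklace (wc n c)) (primitive_words tau) (D2_SP n 3)
      /\ #|D2_SP n 3|%:Z = primitive_count tau) /\
   (~~ odd M -> (4 <= M)%N ->
      bijects_onto (fun c => necklace (wc n c)) (primitive_words tau) (D2_HT n tau)
      /\ #|D2_HT n tau|%:Z = primitive_count tau) /\
   (odd M -> (5 <= M)%N ->
      bijects_onto (fun c => necklace (wc n c)) (primitive_words tau) (D2_SUB n tau)
      /\ #|D2_SUB n tau|%:Z = primitive_count tau)) /\
  ((M = 3%N -> forall N, N \in D2_SP n 3 -> least_in_K2 N tau) /\
   (~~ odd M -> (4 <= M)%N ->
      forall N, N \in D2_HT n tau -> least_in_K2 N tau) /\
   (odd M -> (5 <= M)%N ->
      forall N, N \in D2_SUB n tau ->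
        least_in_K2 N tau /\ unique (strict_period N) tau)).
Proof.
have n0 : (0 < n)%N by apply: ltnW.
have slice_bij_card : (3 <= M)%N ->
    bijects_onto (fun c => necklace (wc n c)) (primitive_words tau) (slice n tau)
    /\ #|slice n tau|%:Z = primitive_count tau.
  by rewrite hM => M3; split; [apply: wc_bijects_onto_slice | apply: card_slice].
have slice_least : (3 <= M)%N -> forall N, N \in slice n tau -> least_in_K2 N tau.
  by rewrite hM => M3 N; apply: least_in_slice => //; apply: ltnW.
have SP : M = 3%N -> D2_SP n 3 = slice n tau.
  by rewrite hM; apply: D2_SP_slice.
have HT : ~~ odd M -> D2_HT n tau = slice n tau.
  by rewrite hM; apply: D2_HT_slice.
have SUB : odd M -> (5 <= M)%N -> D2_SUB n tau = slice n tau.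
  by rewrite hM => oM /ltnW; apply: D2_SUB_slice.
split=> [M2|].
  apply/setP => N; rewrite !inE nz_multiples_half -?hM //.
  suff -> : ~~ odd n by [].
  by rewrite -(divnK htau) -hM M2 oddM.
split; first split=> [M3|]; first by rewrite SP //; apply: slice_bij_card; rewrite M3.
  split=> [eM M4|oM M5]; first by rewrite HT //; apply: slice_bij_card; lia.
  by rewrite SUB //; apply: slice_bij_card; lia.
split=> [M3|]; first by rewrite SP //; apply: slice_least; rewrite M3.
split=> [eM M4|oM M5 N NS]; first by rewrite HT //; apply: slice_least; lia.
have leastN : least_in_K2 N tau by apply: slice_least; rewrite -?SUB //; lia.
(* A strict period [t] has n/t - 1 > 2 nonzero multiples, so [t] too is the least element of [K2]
   and equals [tau]. *)
split=> //; split=> // t [tn]; rewrite inE => /andP[ND /and3P[NK cardN _]].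
apply: least_in_K2_inj leastN (least_in_slice n0 tn _ _); last by rewrite inE ND.
by move: cardN; rewrite (eqP NK) card_nz_multiples //; lia.
Qed.
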